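(* Let $m \geq 2$ be an integer, let $\alpha \in (0,1)$ be real, and let $\mu$ be a nonzero finite Borel measure on $\mathbb{T}$ such that for $\mu$-a.e. $x\in\mathbb{T}$ the upper $\alpha$-density $\Theta^{\alpha,*}(\mu,x)$ is finite and the lower $\alpha$-density $\Theta_{\alpha,*}(\mu,x)$ is positive. Then $$\mathcal{C}_{loc}(\mu,\alpha) \;\geq\; \sup_{i,j \in \mathbb{N}} \max\left( \frac{m^{\alpha i}}{\lfloor m^{\alpha i}\rfloor},\ \frac{\lceil m^{\alpha j}\rceil}{m^{\alpha j}} \right).$$
   Context: Fix an integer $m\ge 2$ and let $\mathbb{T}=\{0,1,\dots,m-1\}^{\mathbb{N}}$ be the set of infinite sequences $a=(a_1,a_2,\dots)$ with entries in $\{0,\dots,m-1\}$. For distinct $a,b\in\mathbb{T}$ let $n(a,b)$ be the first index at which $a$ and $b$ differ, and set $d(a,b)=m^{-n(a,b)+1}$ (and $d(a,a)=0$); $(\mathbb{T},d)$ is a metric space. For an integer $n\ge 0$ and $x\in\mathbb{T}$, $B_n(x)$ denotes the closed ball $B(x,m^{-n})$, which is the set of sequences agreeing with $x$ in the first $n$ positions; such sets are called ($m$-adic) intervals of level $n$ (so $\mathbb{T}$ is the unique interval of level $0$). For a Borel measure $\mu$ on $\mathbb{T}$ and $\alpha>0$, the upper and lower $\alpha$-densities at $x$ are $\Theta^{\alpha,*}(\mu,x)=\limsup_{n\to\infty} m^{\alpha n}\mu(B_n(x))$ and $\Theta_{\alpha,*}(\mu,x)=\liminf_{n\to\infty} m^{\alpha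 n}\mu(B_n(x))$. When upper densities are finite and lower densities positive $\mu$-a.e., define $\mathcal{C}_{loc}(\mu,\alpha)=\operatorname{ess\,sup}_{x\in\mathbb{T}} \frac{\Theta^{\alpha,*}(\mu,x)}{\Theta_{\alpha,*}(\mu,x)}$, the essential supremum taken with respect to $\mu$. $\lfloor x\rfloor$ and $\lceil x\rceil$ denote floor and ceiling; $\mathbb{N}=\{1,2,\dots\}$. *)

(* Defs.v *)
From HB Require Import structures.
From mathcomp Require Import all_boot all_order all_algebra.
From mathcomp Require Import all_classical all_reals all_analysis.
From mathcomp Require Import ess_sup_inf.
Unset Printing Implicit Defensive.
Import Order.TTheory GRing.Theory Num.Theory.
Import numFieldNormedType.Exports.
Local Open Scope classical_set_scope.
Local Open Scope ring_scope.

(* The digit set {0,...,m-1}.  For m >= 2 (the only case used), m.-2.+2 = m;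
   the form m.-2.+2 makes the type canonically pointed. *)
Definition digit (m : nat) := 'I_(m.-2.+2).

(* Sequences a = (a_1, a_2, ...) are indexed from 0: a_k is (a (k-1)). *)
Definition seqT (m : nat) := nat -> digit m.
HB.instance Definition _ (m : nat) := Choice.on (seqT m).
HB.instance Definition _ (m : nat) := isPointed.Build (seqT m) (fun _ => ord0).

Definition Bn (m : nat) (n : nat) (x : seqT m) : set (seqT m) :=
  [set y | forall k, (k < n)%N -> y k = x k].

Definition intervals (m : nat) : set (set (seqT m)) :=
  [set A | exists n x, A = Bn m n x].

(* T with its Borel sigma-algebra: the sigma-algebra generated by the
   m-adic intervals (the balls of the metric d, a countable base). *)
Definition Tm (m : nat) := g_sigma_algebraType (intervals m).

Section densities.
Context {R : realType} {m : nat}.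
Local Open Scope ereal_scope.

Definition dens_seq (mu : {measure set (Tm m) -> \bar R}) (alpha : R)
  (x : Tm m) (n : nat) : \bar R :=
  (powR (m%:R) (alpha * n%:R))%:E * mu (Bn m n x).

Definition upper_density mu alpha x := limn_esup (dens_seq mu alpha x).
Definition lower_density mu alpha x := limn_einf (dens_seq mu alpha x).

(* C_loc(mu, alpha) = ess sup_x (upper / lower); the quotient is computed on
   the real parts, which is the genuine quotient wherever the upper density is
   finite and the lower density positive (mu-a.e. under the hypotheses). *)
Definition Cloc mu alpha : \bar R :=
  ess_sup mu (fun x => ((fine (upper_density mu alpha x)) /
                        (fine (lower_density mu alpha x)))%R%:E).
End densities.

(* Main.v *)
(** Let q_n(x) = m^(alpha n) mu(B_n(x)).  Fix a small e > 0; some set E of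
    positive measure consists of points for which l <= q_n <= u for all n >= N,
    while q_n >= u/(1+e) infinitely often and q_n <= (1+e) l infinitely often.
    There are balls B = B_n(x), x in E, at either kind of level n, with
    mu(B \ E) <= e mu(B).  If k of the level n+i balls inside B meet E, then
    k l <= M q_n(x) and (1-e) M q_n(x) <= k u, where M = m^(alpha i).  When q_n(x)
    is close to u the second bound forces k >= ceil M, and the first then gives
    u/l >= ceil M / M; when q_n(x) is close to l the first bound forces
    k <= floor M, and the second then gives u/l >= (1-e) M / floor M.  Finally
    u/l <= (1+e)^2 C_loc, and e tends to 0. *)

Require Import Defs.
From HB Require Import structures.
From mathcomp Require Import all_boot all_order all_algebra.
From mathcomp Require Import all_classical all_reals all_analysis.
From mathcomp Require Import ess_sup_inf lra.
Import Order.TTheory GRing.Theory Num.Theory.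
Import numFieldNormedType.Exports.
Local Open Scope classical_set_scope.
Local Open Scope ring_scope.
Set Implicit Arguments.
Unset Strict Implicit.

(** * Real-valued calculus for a finite measure *)

Section finite_measure.
Context {R : realType} {d : measure_display} {T : measurableType d}.
Variable mu : {measure set T -> \bar R}.
Hypothesis hfin : (mu setT < +oo)%E.

Lemma measure_fin_num (A : set T) : measurable A -> mu A \is a fin_num.
Proof.
move=> mA; rewrite ge0_fin_numE//.
by apply: le_lt_trans hfin; apply: le_measure; rewrite ?inE.
Qed.

Lemma measure_fineE (A : set T) : measurable A -> mu A = (fine (mu A))%:E.
Proof. by move=> mA; rewrite fineK// measure_fin_num. Qed.

Lemma fine_measure_ge0 (A : set T) : 0 <= fine (mu A).
Proof. exact: fine_ge0. Qed.

Lemma fine_measure_le (A B : set T) :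
  measurable A -> measurable B -> A `<=` B -> fine (mu A) <= fine (mu B).
Proof.
move=> mA mB AB; rewrite -lee_fin -!measure_fineE//.
by apply: le_measure; rewrite ?inE.
Qed.

Lemma fine_measureDI (A B : set T) : measurable A -> measurable B ->
  fine (mu A) = fine (mu (A `\` B)) + fine (mu (A `&` B)).
Proof.
move=> mA mB; rewrite (measureDI mu mA mB) fineD//; apply: measure_fin_num.
  exact: measurableD.
exact: measurableI.
Qed.

(** The fibres of a map into a finite type are disjoint and cover the space. It is applied to
    [prefix n], whose fibres are the nonempty pieces of a splitting into level [n] balls. *)
Lemma fine_measure_partition (F : finType) (p : T -> F) (A : set T) :
  (forall f, measurable (p @^-1` [set f])) -> measurable A ->
  fine (mu A) = \sum_f fine (mu (A `&` p @^-1` [set f])).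
Proof.
move=> mp mA.
have mAp f : measurable (A `&` p @^-1` [set f]) by exact: measurableI.
have {1}-> : A = \bigcup_(f in [set: F]) (A `&` p @^-1` [set f]).
  by apply/seteqP; split => [x Ax|x [f _ []]//]; exists (p x).
rewrite measure_fin_bigcup//; first last.
- by move=> f g _ _ [x [[_ /= <-] [_ /= <-]]].
- exact: finite_finset.
have -> : [set: F] = [set` index_enum F].
  by apply/seteqP; split => // f _; exact: mem_index_enum.
rewrite -fsbig_seq ?index_enum_uniq//.
rewrite (eq_bigr (fun f => (fine (mu (A `&` p @^-1` [set f])))%:E)) ?sumEFin//.
by move=> f _; exact: measure_fineE.
Qed.

(** Continuity from below, in the form of a bound that survives the limit. *)
Lemma fine_measure_bigcup_le (F : (set T)^nat) (s : R) :
  (forall n, measurable (F n)) -> nondecreasing_seq F ->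
  (forall n, fine (mu (F n)) <= s) -> fine (mu (\bigcup_n F n)) <= s.
Proof.
move=> mF ndF Fs.
have mU : measurable (\bigcup_n F n) by exact: bigcupT_measurable.
rewrite -lee_fin -measure_fineE//.
have cF : mu \o F @ \oo --> mu (\bigcup_n F n) by exact: nondecreasing_cvg_mu.
rewrite -(cvg_lim _ cF)//; apply: lime_le.
  by apply/cvg_ex; exists (mu (\bigcup_n F n)).
by apply: nearW => n /=; rewrite measure_fineE// lee_fin.
Qed.

End finite_measure.

(** * Balls, prefixes and unions of balls of a fixed level *)

Section cylinders.
Context {m : nat}.

(** The codomain is a finite type, so that level [n] balls can be counted and summed over. *)
Definition prefix (n : nat) (x : Tm m) : {ffun 'I_n -> digit m} :=
  [ffun k : 'I_n => x k].

(** These are the unions of level [n] balls; stating this as saturation avoids choosing centres. *)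
Definition cylindrical (n : nat) (A : set (Tm m)) :=
  forall x y, A x -> Bn m n x y -> A y.

Lemma Bn_sym n x y : Bn m n x y -> Bn m n y x.
Proof. by move=> xy k kn; rewrite xy. Qed.

Lemma Bn_eq n x y : Bn m n x y -> Bn m n y = Bn m n x.
Proof.
move=> xy; apply/seteqP; split => z zk k kn; first by rewrite zk// xy.
by rewrite zk// xy.
Qed.

Lemma Bn_le n n' x : (n <= n')%N -> Bn m n' x `<=` Bn m n x.
Proof. by move=> nn' y yx k kn; apply: yx; exact: leq_trans nn'. Qed.

Lemma prefixP n x y : prefix n x = prefix n y <-> Bn m n y x.
Proof.
split=> [/ffunP xy k kn|xy].
  by have := xy (Ordinal kn); rewrite !ffunE.
by apply/ffunP => k; rewrite !ffunE xy.
Qed.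

Lemma measurable_Bn n x : measurable (Bn m n x : set (Tm m)).
Proof. by apply: sub_sigma_algebra; exists n, x. Qed.

Lemma cylindrical_le n n' A :
  (n <= n')%N -> cylindrical n A -> cylindrical n' A.
Proof. by move=> nn' cA x y Ax /(Bn_le nn'); exact: cA. Qed.

Lemma cylindricalI n A B :
  cylindrical n A -> cylindrical n B -> cylindrical n (A `&` B).
Proof. by move=> cA cB x y [Ax Bx] xy; split; [exact: cA xy|exact: cB xy]. Qed.

Lemma cylindricalC n A : cylindrical n A -> cylindrical n (~` A).
Proof. by move=> cA x y Ax xy Ay; apply: Ax; apply: cA Ay _; exact: Bn_sym. Qed.

(** There are finitely many prefixes of length [n], so [A] is a finite union of balls. For each
    prefix attained on [A], [cid2] picks a centre in [A]. *)
Lemma cylindrical_measurable n A : cylindrical n A -> measurable A.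
Proof.
move=> cA.
have -> : A = \bigcup_(w in prefix n @` A)
    (if pselect (exists2 x, A x & prefix n x = w) is left e
     then Bn m n (projT1 (cid2 e)) else set0).
  apply/seteqP; split => [x Ax|x [w [y Ay yw]]].
    exists (prefix n x); first by exists x.
    case: pselect => [e|[]]; last by exists x.
    by case: cid2 => y /= Ay /esym /prefixP.
  case: pselect => // e; case: cid2 => z /= Az _; exact: cA Az.
apply: fin_bigcup_measurable => [|w _]; first exact: finite_finset.
by case: pselect => // e; exact: measurable_Bn.
Qed.

Lemma cylindrical_prefix n w : cylindrical n (prefix n @^-1` [set w]).
Proof. by move=> x y /= <- /prefixP. Qed.

Lemma measurable_prefix n w : measurable (prefix n @^-1` [set w]).
Proof. exact: cylindrical_measurable (@cylindrical_prefix n w). Qed.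

End cylinders.

(** * Approximation of measurable sets by cylindrical ones *)

Section approximation.
Context {R : realType} {m : nat}.
Variable mu : {measure set (Tm m) -> \bar R}.
Hypothesis hfin : (mu setT < +oo)%E.
Let r (A : set (Tm m)) : R := fine (mu A).

Let rU A B C : measurable A -> measurable B -> measurable C ->
  A `<=` B `|` C -> r A <= r B + r C.
Proof.
move=> mA mB mC AB; rewrite /r (fine_measureDI hfin mA mB) addrC lerD//.
  exact: fine_measure_le (measurableI _ _ mA mB) mB (@subIsetr _ _ _).
apply: fine_measure_le (measurableD mA mB) mC _ => //.
by move=> x [Ax nBx]; case: (AB x Ax).
Qed.

(** The sets that can be so approximated contain the intervals and form a sigma-algebra, hence
    include all measurable sets. *)
Lemma cylindrical_approx (A : set (Tm m)) : measurable A ->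
  forall e : R, 0 < e -> exists n C,
    cylindrical n C /\ fine (mu (A `\` C)) + fine (mu (C `\` A)) < e.
Proof.
pose good := [set A | measurable A /\ forall e : R, 0 < e -> exists n C,
    cylindrical n C /\ r (A `\` C) + r (C `\` A) < e].
suff : measurable `<=` good by move=> /[apply] -[].
apply: smallest_sub => [|_ [n [x ->]]]; last first.
  split; first exact: measurable_Bn.
  move=> e e0; exists n, (Bn m n x); split; last by rewrite setDv /r measure0 addr0.
  by move=> y z xy yz k kn; rewrite yz// xy.
split.
- split=> // e e0; exists 0%N, set0; split=> //.
  by rewrite setDv /r measure0 addr0.
- move=> B [mB gB]; rewrite setTD; split; first exact: measurableC.
  move=> e /gB [n [C [cC Ce]]]; exists n, (~` C); split.
    exact: cylindricalC.
  have setDCC (X Y : set (Tm m)) : ~` X `\` ~` Y = Y `\` X.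
    by rewrite !setDE setCK setIC.
  by rewrite !setDCC addrC.
- change (forall F : (set (Tm m))^nat,
    (forall k, good (F k)) -> good (\bigcup_k F k)) => F gF.
  have mF k : measurable (F k) by case: (gF k).
  have mU : measurable (\bigcup_k F k) by exact: bigcupT_measurable.
  split=> // e e0.
  pose G K := \bigcup_(k < K) F k.
  have mG K : measurable (G K) by apply: bigcup_measurable => k _.
  have GU : \bigcup_K G K = \bigcup_k F k.
    apply/seteqP; split=> [x [K _ [k _ Fk]]|x [k _ Fk]]; first by exists k.
    by exists k.+1 => //; exists k => //=.
  (* A finite union already carries all but [e / 2] of the mass, by continuity from below; the other
     [e / 2] is shared among its members. *)
  have [K GK] : exists K, r (\bigcup_k F k) - e / 2 < r (G K).
    apply: contrapT => /forallNP H.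
    have : r (\bigcup_k F k) <= r (\bigcup_k F k) - e / 2.
      rewrite -{1}GU; apply: fine_measure_bigcup_le => // [K K' KK'|K].
        apply/subsetPset => x [k /= kK Fk]; exists k => //=; exact: leq_trans KK'.
      by rewrite leNgt; apply/negP/H.
    by lra.
  have {GK} GK : r (\bigcup_k F k `\` G K) < e / 2.
    move: GK; rewrite /r (fine_measureDI hfin mU (mG K)).
    have -> : \bigcup_k F k `&` G K = G K.
      by apply/setIidPr => x [k _ Fk]; exists k.
    by lra.
  (* The divisor is [K.+1] rather than [K] so that the tolerance is also meaningful for [K = 0]. *)
  have K0 : 0 < e / 2 / K.+1%:R by rewrite !divr_gt0.
  suff [n [C [cC Ce]]] : exists n C, cylindrical n C /\
      r (G K `\` C) + r (C `\` G K) <= K%:R * (e / 2 / K.+1%:R).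
    have mC := cylindrical_measurable cC.
    exists n, C; split => //.
    have Ke : K%:R * (e / 2 / K.+1%:R) <= e / 2.
      rewrite mulrA ler_pdivrMr// mulrC ler_pM2l ?divr_gt0//.
      by rewrite ler_nat.
    have h1 : r (\bigcup_k F k `\` C) <=
        r (\bigcup_k F k `\` G K) + r (G K `\` C).
      apply: rU; [exact: measurableD..|] => x [Fx nC].
      by have [Gx|nGx] := pselect (G K x); [right|left].
    have h2 : r (C `\` \bigcup_k F k) <= r (C `\` G K).
      apply: fine_measure_le => //; [exact: measurableD..|] => x [Cx nF].
      by split=> // -[k _ Fk]; apply: nF; exists k.
    apply: le_lt_trans (lerD h1 h2) _.
    by rewrite -addrA (splitr e) ltr_leD// (le_trans Ce).
  (* The tolerance depends on [K], so it is generalized to a fixed [s] before the induction. *)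
  elim: K (e / 2 / _) K0 {GK} => [|K IH] s s0.
    exists 0%N, set0; split=> //; rewrite /G mul0r set0D setD0 bigcup_mkord big_ord0.
    by rewrite /r measure0 addr0.
  have [n [C [cC Ce]]] := IH s s0.
  have [n' [C' [cC' Ce']]] := (gF K).2 s s0.
  have mC := cylindrical_measurable cC.
  have mC' := cylindrical_measurable cC'.
  have GS : G K.+1 = G K `|` F K by rewrite /G !bigcup_mkord big_ord_recr.
  have cCC' : cylindrical (maxn n n') (C `|` C').
    move=> x y [Cx|Cx] xy; [left|right].
      by apply: cC Cx _; apply: Bn_le xy; exact: leq_maxl.
    by apply: cC' Cx _; apply: Bn_le xy; exact: leq_maxr.
  exists (maxn n n'), (C `|` C'); split=> //.
  rewrite GS.
  have h1 : r ((G K `|` F K) `\` (C `|` C')) <= r (G K `\` C) + r (F K `\` C').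
    apply: rU; [apply: measurableD; exact: measurableU|exact: measurableD..|].
    move=> x [[Gx|Fx] nC]; [left|right]; split=> // ?; apply: nC; by [left|right].
  have h2 : r ((C `|` C') `\` (G K `|` F K)) <= r (C `\` G K) + r (C' `\` F K).
    apply: rU; [apply: measurableD; exact: measurableU|exact: measurableD..|].
    move=> x [[Gx|Fx] nC]; [left|right]; split=> // ?; apply: nC; by [left|right].
  rewrite -natr1 mulrDl mul1r; lra.
Qed.

End approximation.

(** * Balls mostly inside a set, and counting their sub-balls *)

Section balls.
Context {R : realType} {m : nat}.
Variable mu : {measure set (Tm m) -> \bar R}.
Hypothesis hfin : (mu setT < +oo)%E.
Let r (A : set (Tm m)) : R := fine (mu A).

Lemma cylindricalI_prefix n (G : set (Tm m)) x : cylindrical n G -> G x ->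
  G `&` prefix n @^-1` [set prefix n x] = Bn m n x.
Proof.
move=> cG Gx; apply/seteqP; split => [y [_ /= /prefixP]//|y xy].
by split; [exact: cG Gx xy|exact/prefixP].
Qed.

(** Each fibre of [prefix n] meets [G] in a whole ball or not at all, so the hypothesis is summed
    ball by ball. *)
Lemma cylindrical_measure_le n (G E : set (Tm m)) (e : R) :
  measurable E -> cylindrical n G ->
  (forall x, G x -> e * r (Bn m n x) <= r (Bn m n x `\` E)) ->
  e * r G <= r (G `\` E).
Proof.
move=> mE cG GE.
have mG := cylindrical_measurable cG.
have mp := @measurable_prefix m n.
rewrite /r (fine_measure_partition hfin mp mG).
rewrite (fine_measure_partition hfin mp (measurableD mG mE)).
rewrite mulr_sumr; apply: ler_sum => w _.
rewrite setIDAC setIDA.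
have [[x [Gx /= <-]]|] := pselect ((G `&` prefix n @^-1` [set w]) !=set0).
  by rewrite cylindricalI_prefix//; exact: GE.
by move=> /set0P/negP/negPn/eqP ->; rewrite set0D measure0 mulr0.
Qed.

(* This replaces the density theorem.  Approximate E by a cylindrical set C; if
   the conclusion failed, the maximal balls B inside C around points of
   E `&` P n would be disjoint, would cover E `&` C, and would satisfy
   e * mu B <= mu (B `\` E), hence e * mu (E `&` C) <= mu (C `\` E).  The set
   [K k] below is the union of those of level < M + k. *)
Lemma exists_ball_mostly_inside (E : set (Tm m)) (P : nat -> set (Tm m)) (e : R) (N0 : nat) :
  measurable E -> 0 < r E -> (forall n, cylindrical n (P n)) ->
  (forall x, E x -> forall N, exists2 n, (N <= n)%N & P n x) -> 0 < e ->
  exists n x, [/\ (N0 <= n)%N, E x, P n x &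
    r (Bn m n x `\` E) <= e * r (Bn m n x)].
Proof.
move=> mE E0 cP EP e0; apply: contrapT => H.
have {}H n x : (N0 <= n)%N -> E x -> P n x ->
    e * r (Bn m n x) <= r (Bn m n x `\` E).
  move=> Nn Ex Px; apply/ltW; rewrite ltNge; apply/negP => xE.
  by apply: H; exists n, x; split.
(* With this tolerance, [e * r (E]&[C) <= r (C]\[E)] would give
   [e * r E <= (1 + e) * (r (E]\[C) + r (C]\[E)) < e * r E]. *)
have s0 : 0 < e * r E / (1 + e) by rewrite divr_gt0 ?mulr_gt0 ?addr_gt0.
have [n0 [C [cC]]] := cylindrical_approx hfin mE s0; rewrite -!/(r _) => Cs.
have mC := cylindrical_measurable cC.
(* From level [M] on, [C] is cylindrical and [H] applies. *)
pose M := maxn N0 n0.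
(* [E] need not be cylindrical; passing to the whole balls around its points makes [bad n] so. *)
pose bad n := [set x | exists y, [/\ E y, P n y & Bn m n y x]].
have cbad n : cylindrical n (bad n).
  by move=> x z [y [Ey Py yx]] xz; exists y; split=> // k kn; rewrite xz// yx.
pose K k := C `&` [set x | exists2 j, (j < k)%N & bad (M + j)%N x].
have cK k : cylindrical (M + k) (K k).
  apply: cylindricalI.
    by apply: cylindrical_le cC; rewrite (leq_trans (leq_maxr N0 n0)) ?leq_addr.
  move=> x y [j jk bx] xy; exists j => //; apply: cbad bx _.
  by apply: Bn_le xy; rewrite leq_add2l ltnW.
have mK k : measurable (K k) := cylindrical_measurable (cK k).
have eK k : e * r (K k) <= r (K k `\` E).
  elim: k => [|k IH].
    have -> : K 0 = set0 by apply/seteqP; split=> // x [_ []].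
    by rewrite set0D /r measure0 mulr0.
  rewrite /r (fine_measureDI hfin (mK k.+1) (mK k)).
  rewrite (fine_measureDI hfin (measurableD (mK k.+1) mE) (mK k)).
  have -> : K k.+1 `&` K k = K k.
    apply/setIidPr => x [Cx [j jk bx]]; split=> //; exists j => //.
    exact: leq_trans jk _.
  have -> : (K k.+1 `\` E) `&` K k = K k `\` E.
    apply/seteqP; split=> [x [[_ nE] Kx]//|x [[Cx [j jk bx]] nE]].
    split=> //; last by split=> //; exists j.
    by split=> //; split=> //; exists j => //; exact: leq_trans jk _.
  rewrite mulrDr lerD//.
  have -> : (K k.+1 `\` E) `\` K k = (K k.+1 `\` K k) `\` E.
    by rewrite !setDDl setUC.
  have sK x : (K k.+1 `\` K k) x -> bad (M + k)%N x.
    move=> [[Cx [j jk bx]] nK]; have [jk'|jk'] := ltnP j k.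
      by exfalso; apply: nK; split=> //; exists j.
    by have -> : k = j by apply/eqP; rewrite eqn_leq jk' -ltnS.
  (* The layer added at stage [k] consists of whole balls of level [M + k], on each of which [H]
     gives the inequality. *)
  apply: (@cylindrical_measure_le (M + k)) => // [x y [Kx nKx] xy|x /sK].
    have bx := sK x (conj Kx nKx).
    split; last by move=> Ky; apply: nKx; apply: cK Ky _; exact: Bn_sym.
    split; last by exists k => //; exact: cbad bx xy.
    apply: (cC x) => //; first by case: Kx.
    by apply: Bn_le xy; rewrite (leq_trans (leq_maxr N0 n0)) ?leq_addr.
  move=> [y [Ey Py yx]]; rewrite (Bn_eq yx); apply: H => //.
  by rewrite (leq_trans (leq_maxl N0 n0)) ?leq_addr.
have rCE k : r (K k) <= r (C `\` E) / e.
  rewrite ler_pdivlMr// mulrC (le_trans (eK k))//.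
  apply: fine_measure_le => //; [exact: measurableD..|].
  by move=> x [[]].
have UK : r (E `&` C) <= r (C `\` E) / e.
  apply: le_trans (fine_measure_bigcup_le hfin mK _ rCE).
    apply: fine_measure_le => //; [exact: measurableI|exact: bigcupT_measurable|].
    move=> x [Ex Cx]; have [n Mn Pn] := EP x Ex M.
    exists (n - M).+1 => //; split=> //; exists (n - M)%N => //.
    by rewrite subnKC//; exists x.
  move=> k k' kk'; apply/subsetPset => x [Cx [j jk bx]]; split=> //.
  by exists j => //; exact: leq_trans kk'.
move: UK Cs; rewrite ler_pdivlMr// ltr_pdivlMr ?addr_gt0//.
rewrite [r E](fine_measureDI hfin mE mC) -!/(r _).
have := fine_measure_ge0 mu (E `\` C); have := fine_measure_ge0 mu (C `\` E).
rewrite -!/(r _); nra.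
Qed.

(** The witness [k] is the number of level [n'] balls inside [Bn m n x] that meet [E]. Dropping the
    other balls gives the lower bound; they miss [E], so their mass is at most that of [Bn m n x]
    outside [E], which gives the upper bound. *)
Lemma ball_mass_count (E : set (Tm m)) n n' x (a b : R) :
  measurable E -> (n <= n')%N ->
  (forall y, E y -> a <= r (Bn m n' y) <= b) ->
  exists k : nat, k%:R * a <= r (Bn m n x) /\
                  r (Bn m n x) <= k%:R * b + r (Bn m n x `\` E).
Proof.
move=> mE nn' ab; set B := Bn m n x.
have cB : cylindrical n' B.
  by move=> y z yx yz k kn; rewrite yz ?yx// (leq_trans kn).
have mB := cylindrical_measurable cB.
have mp := @measurable_prefix m n'.
pose K w := `[< exists y, [/\ E y, B y & prefix n' y = w] >].
have abK w : K w -> a <= r (B `&` prefix n' @^-1` [set w]) <= b.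
  by move=> /asboolP[y [Ey By <-]]; rewrite cylindricalI_prefix// ab.
exists #|K|; split.
  rewrite [r B](fine_measure_partition hfin mp mB) mulr_natl (bigID K)/=.
  rewrite ler_wpDr ?sumr_ge0//.
  rewrite -sumr_const; apply: ler_sum => w Kw.
  by have /andP[] := abK w Kw.
rewrite [leLHS](fine_measure_partition hfin mp mB) (bigID K)/=.
rewrite lerD//.
  rewrite mulr_natl -sumr_const; apply: ler_sum => w Kw.
  by have /andP[] := abK w Kw.
rewrite [leRHS](fine_measure_partition hfin mp (measurableD mB mE)).
rewrite [leRHS](bigID K)/= ler_wpDl ?sumr_ge0//.
apply: ler_sum => w nKw; rewrite setIDAC setIDA.
have -> // : (B `&` prefix n' @^-1` [set w]) `\` E = B `&` prefix n' @^-1` [set w].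
rewrite setDE; apply/setIidPl => y [By yw] Ey.
by move/negP: nKw; apply; apply/asboolP; exists y; split.
Qed.

End balls.

(** * Upper and lower limits as eventual and recurrent inequalities *)

Section limsup.
Context {R : realType}.
Implicit Types (u : (\bar R)^nat) (a : \bar R).
Local Open Scope ereal_scope.

Lemma limn_esup_lt u a : limn_esup u < a ->
  exists N, forall n, (N <= n)%N -> u n < a.
Proof.
move=> /ereal_inf_lt[_ [V [N _ NV] <-]] Va; exists N => n Nn.
by apply: le_lt_trans Va; apply: ereal_sup_ubound; exists n => //; exact: NV.
Qed.

Lemma limn_esup_gt u a : a < limn_esup u ->
  forall N, exists2 n, (N <= n)%N & a < u n.
Proof.
move=> au N; have : a < ereal_sup (u @` [set n | (N <= n)%N]).
  apply: lt_le_trans au _; apply: ereal_inf_lbound.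
  by exists [set n | (N <= n)%N] => //; exact: nbhs_infty_ge.
by move=> /ereal_sup_gt[_ [n Nn <-] an]; exists n.
Qed.

Lemma limn_esup_ge u a : (forall N, exists2 n, (N <= n)%N & a <= u n) ->
  a <= limn_esup u.
Proof.
move=> ua; apply: le_ereal_inf_tmp => _ [V [N _ NV] <-].
have [n Nn /le_trans] := ua N; apply.
by apply: ereal_sup_ubound; exists n => //; exact: NV.
Qed.

Lemma limn_einf_gt u a : a < limn_einf u ->
  exists N, forall n, (N <= n)%N -> a < u n.
Proof.
rewrite /limn_einf lteNr => /limn_esup_lt[N uN]; exists N => n /uN.
by rewrite lteN2.
Qed.

Lemma limn_einf_lt u a : limn_einf u < a ->
  forall N, exists2 n, (N <= n)%N & u n < a.
Proof.
rewrite /limn_einf lteNl => /limn_esup_gt ua N; have [n Nn] := ua N.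
by rewrite lteN2; exists n.
Qed.

Lemma limn_einf_le u a : (forall N, exists2 n, (N <= n)%N & u n <= a) ->
  limn_einf u <= a.
Proof.
move=> ua; rewrite /limn_einf leeNl; apply: limn_esup_ge => N.
by have [n Nn un] := ua N; exists n; rewrite ?leeN2.
Qed.

End limsup.

(** * From counts to ceilings and floors, and removal of the error *)

Section counting.
Context {R : realType}.
Variables (k : nat) (M l u q e : R).
Hypotheses (l0 : 0 < l) (e0 : 0 < e) (M0 : 0 < M) (q0 : 0 < q).
Hypotheses (kl : k%:R * l <= M * q) (ku : (1 - e) * (M * q) <= k%:R * u).

(** Here [(1 - e) * M * q <= k * u <= k * (1 + e) * q], so [k] exceeds [ceil M - 1]. Being an
    integer, [k] is at least [ceil M], and [kl] concludes. *)
Lemma ceil_count : q <= u -> u <= (1 + e) * q ->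
  (1 + e) * ((Num.ceil M)%:~R - 1) < (1 - e) * M ->
  (Num.ceil M)%:~R * l <= M * u.
Proof.
move=> qu uq eM.
have kM : (1 - e) * M <= (1 + e) * k%:R.
  rewrite -(ler_pM2r q0) -mulrA (le_trans ku)// [leRHS]mulrAC mulrC ler_wpM2r//.
have : (Num.ceil M)%:~R - 1 < (k%:Z)%:~R :> R.
  by rewrite -(@ltr_pM2l _ (1 + e)) ?addr_gt0// (lt_le_trans eM).
rewrite -[1]/(1%:~R) -rmorphB/= ltr_int ltrBlDr => Mk.
have {}Mk : Num.ceil M <= k%:Z by rewrite -ltzD1.
rewrite (le_trans (y := k%:R * l)) ?ler_pM2r//; first by rewrite -(ler_int R) in Mk.
by rewrite (le_trans kl)// ler_pM2l.
Qed.

(** Dually, [k * l <= M * q <= (1 + e) * M * l] puts [k] below [floor M + 1], hence [k <= floor M],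
    and [ku] concludes. *)
Lemma floor_count : l <= q -> q <= (1 + e) * l -> 0 < u -> e < 1 ->
  (1 + e) * M < (Num.floor M)%:~R + 1 ->
  (1 - e) * (M * l) <= (Num.floor M)%:~R * u.
Proof.
move=> lq ql u0 e1 eM.
have kM : k%:R <= (1 + e) * M.
  rewrite -(ler_pM2r l0) (le_trans kl)// [leRHS]mulrAC mulrC ler_wpM2r//.
  exact: ltW.
have : (k%:Z)%:~R < (Num.floor M)%:~R + 1 :> R by exact: le_lt_trans eM.
rewrite -[1]/(1%:~R) -rmorphD/= ltr_int ltzD1 => Mk.
rewrite (le_trans (y := k%:R * u)) ?ler_pM2r//; last by rewrite -(ler_int R) in Mk.
by rewrite (le_trans _ ku)// ler_pM2l ?subr_gt0// ler_pM2l.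
Qed.

End counting.

Lemma le_of_small_error {R : realType} (t c e0 : R) : 0 < e0 -> 0 <= t ->
  (forall e, 0 < e -> e < e0 -> (1 - e) * t <= (1 + e) ^+ 2 * c) -> t <= c.
Proof.
move=> e00 t0 H; rewrite leNgt; apply/negP => ct.
have [c0|c0] := ltP c 0.
  have d0 : 0 < Num.min (e0 / 2) 1 by rewrite lt_min divr_gt0//=.
  have de : Num.min (e0 / 2) 1 < e0.
    by rewrite gt_min; apply/orP; left; lra.
  have d1 : Num.min (e0 / 2) 1 <= 1 by rewrite ge_min lexx orbT.
  move: (Num.min _ _) d0 de d1 => d d0 de d1.
  have := H d d0 de; have : 0 <= (1 - d) * t by rewrite mulr_ge0// subr_ge0.
  have : (1 + d) ^+ 2 * c < 0 by rewrite pmulr_rlt0// exprn_gt0// addr_gt0.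
  by lra.
(* For [0 < d <= 1], [(1 + d) ^+ 2 <= 1 + 3 * d], so the hypothesis at [d] gives
   [t - c <= d * (t + 3 * c)]; with [d <= s] the right side is at most half of [t - c]. *)
pose s := (t - c) / (2 * (t + 3 * c)).
have tc : 0 < t + 3 * c by lra.
have s0 : 0 < s by rewrite /s divr_gt0 ?mulr_gt0 ?subr_gt0.
have d0 : 0 < Num.min (e0 / 2) (Num.min 1 s).
  by rewrite !lt_min divr_gt0//= ltr01.
have de : Num.min (e0 / 2) (Num.min 1 s) < e0.
  by rewrite gt_min; apply/orP; left; lra.
have d1 : Num.min (e0 / 2) (Num.min 1 s) <= 1 by rewrite !ge_min lexx !orbT.
have ds : Num.min (e0 / 2) (Num.min 1 s) <= s by rewrite !ge_min lexx !orbT.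
move: (Num.min _ _) d0 de d1 ds => d d0 de d1.
rewrite /s ler_pdivlMr ?mulr_gt0// => ds.
have := H d d0 de; nra.
Qed.

(** * Bands of points with nearly constant densities *)

Section density_bands.
Context {R : realType} {m : nat}.
Hypothesis hm : (2 <= m)%N.
Variable alpha : R.
Hypothesis alpha0 : 0 < alpha.
Variable mu : {measure set (Tm m) -> \bar R}.
Hypothesis hfin : (mu setT < +oo)%E.

Definition scale (n : nat) : R := powR m%:R (alpha * n%:R).

Definition scaled_mass (n : nat) (x : Tm m) : R :=
  scale n * fine (mu (Bn m n x)).

Lemma scale_ge1 n : 1 <= scale n.
Proof.
rewrite -[leLHS](@powRr0 _ m%:R) ler_powR ?ler1n ?(ltnW hm)//.
by rewrite mulr_ge0// ltW.
Qed.

Lemma scale_gt0 n : 0 < scale n.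
Proof. exact: lt_le_trans ltr01 (scale_ge1 n). Qed.

Lemma scaleD n n' : scale (n + n') = scale n * scale n'.
Proof.
rewrite /scale natrD mulrDr powRD//.
by apply/implyP => _; rewrite pnatr_eq0 -lt0n (ltn_trans _ hm).
Qed.

Lemma dens_seqE x n : dens_seq mu alpha x n = (scaled_mass n x)%:E.
Proof.
rewrite /dens_seq (measure_fineE hfin (measurable_Bn n x)) -EFinM.
by [].
Qed.

Lemma cylindrical_scaled_mass n (P : R -> Prop) :
  cylindrical n [set x | P (scaled_mass n x)].
Proof. by move=> x y /= Px xy; rewrite /scaled_mass (Bn_eq xy). Qed.

(** Written with countable intersections and unions of cylindrical sets, so that measurability is
    immediate. *)
Definition density_band (l u e : R) (N : nat) : set (Tm m) :=
  (\bigcap_(n in [set n | (N <= n)%N]) [set x | l <= scaled_mass n x <= u]) `&`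
  (\bigcap_j \bigcup_(n in [set n | (j <= n)%N])
    [set x | u <= (1 + e) * scaled_mass n x]) `&`
  (\bigcap_j \bigcup_(n in [set n | (j <= n)%N])
    [set x | scaled_mass n x <= (1 + e) * l]).

Lemma measurable_density_band l u e N : measurable (density_band l u e N).
Proof.
have mq n (P : R -> Prop) : measurable [set x | P (scaled_mass n x)].
  exact: cylindrical_measurable (@cylindrical_scaled_mass n P).
apply: measurableI; first apply: measurableI; apply: bigcap_measurableType => n _.
- exact: (mq n (fun q => is_true (l <= q <= u))).
- by apply: bigcup_measurable => k _; exact: (mq k (fun q => is_true (u <= (1 + e) * q))).
- by apply: bigcup_measurable => k _; exact: (mq k (fun q => is_true (q <= (1 + e) * l))).
Qed.

(** [P] stands for closeness of [q] to [u] or to [l]. A ball mostly inside the band is chosen at a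
    level where [P] holds, and its sub-balls [i] levels deeper are counted. *)
Lemma density_band_count l u e N i (P : R -> Prop) :
  0 < fine (mu (density_band l u e N)) -> 0 < e ->
  (forall x, density_band l u e N x ->
    forall j, exists2 n, (j <= n)%N & P (scaled_mass n x)) ->
  exists k q, [/\ l <= q <= u, P q, k%:R * l <= scale i * q &
    (1 - e) * (scale i * q) <= k%:R * u].
Proof.
move=> E0 e0 EP; set E := density_band l u e N in E0 EP.
have mE : measurable E by exact: measurable_density_band.
have [n [x [Nn Ex Px Bx]]] := exists_ball_mostly_inside hfin N mE E0
  (fun n => @cylindrical_scaled_mass n P) EP e0.
have lu n' y : (N <= n')%N -> E y -> l <= scaled_mass n' y <= u.
  by move=> Nn' [[h _] _]; exact: h.
have [k [kl ku]] : exists k : nat,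
    k%:R * (l / scale (n + i)) <= fine (mu (Bn m n x)) /\
    fine (mu (Bn m n x)) <= k%:R * (u / scale (n + i)) + fine (mu (Bn m n x `\` E)).
  apply: (ball_mass_count hfin x mE (leq_addr i n)) => y Ey.
  rewrite ler_pdivrMr ?ler_pdivlMr ?scale_gt0//.
  by rewrite ![_ * scale _]mulrC; apply: lu => //; rewrite (leq_trans Nn) ?leq_addr.
exists k, (scaled_mass n x); split => //; first exact: lu.
  (* Multiplying by [scale (n + i) = scale n * scale i] turns masses into the scaled mass [q] at
     level [n]. *)
  move: kl; rewrite mulrA ler_pdivrMr ?scale_gt0// scaleD /scaled_mass.
  by lra.
have {ku Bx} : (1 - e) * fine (mu (Bn m n x)) <= k%:R * u / scale (n + i).
  move: (le_trans ku (lerD (lexx _) Bx)); rewrite mulrA; lra.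
rewrite ler_pdivlMr ?scale_gt0// scaleD /scaled_mass; lra.
Qed.

Lemma density_band_ratio (e c : R) l u N i : 0 < l -> 0 < e -> e < 1 ->
  0 < fine (mu (density_band l u e N)) -> u <= (1 + e) ^+ 2 * c * l ->
  ((1 + e) * ((Num.ceil (scale i))%:~R - 1) < (1 - e) * scale i ->
    (1 - e) * ((Num.ceil (scale i))%:~R / scale i) <= (1 + e) ^+ 2 * c) /\
  ((1 + e) * scale i < (Num.floor (scale i))%:~R + 1 ->
    (1 - e) * (scale i / (Num.floor (scale i))%:~R) <= (1 + e) ^+ 2 * c).
Proof.
move=> l0 e0 e1 E0 uc; have M0 := scale_gt0 i.
split=> [ceM|flM].
  have [|k [q [/andP[lq qu] uq kl ku]]] :=
      density_band_count i (P := fun q => is_true (u <= (1 + e) * q)) E0 e0.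
    by move=> x [[_ h] _] j; have [n jn un] := h j I; exists n.
  have q0 := lt_le_trans l0 lq.
  have := ceil_count l0 e0 M0 q0 kl ku qu uq ceM.
  move=> /le_trans-/(_ _ (ler_wpM2l (ltW M0) uc)).
  rewrite !mulrA ler_pM2r// => H.
  have C0 : 0 <= (Num.ceil (scale i))%:~R :> R.
    by rewrite ler0z -ltzD1 ltr_wpDl// ltW// ceil_gt0.
  rewrite ler_pdivrMr// [leRHS]mulrC !mulrA (le_trans _ H)//.
  by rewrite ler_piMl// lerBlDr lerDl ltW.
have [|k [q [/andP[lq qu] ql kl ku]]] :=
    density_band_count i (P := fun q => is_true (q <= (1 + e) * l)) E0 e0.
  by move=> x [_ h] j; have [n jn un] := h j I; exists n.
have q0 := lt_le_trans l0 lq.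
have F0 : 0 < (Num.floor (scale i))%:~R :> R.
  by rewrite ltr0z floor_gt0 scale_ge1.
have := floor_count l0 M0 kl ku lq ql (lt_le_trans q0 qu) e1 flM.
move=> /le_trans-/(_ _ (ler_wpM2l (ltW F0) uc)).
rewrite !mulrA ler_pM2r// => H.
by rewrite ler_pdivrMr//; lra.
Qed.

(** * Bands of positive measure and the essential supremum *)

Hypothesis hnz : mu setT != 0%E.
Hypothesis hup : \forall x \ae mu, (upper_density mu alpha x < +oo)%E.
Hypothesis hlow : \forall x \ae mu, (0 < lower_density mu alpha x)%E.

(** Since the lower limit is at most the upper one, neither density is infinite; hence the quotient
    of [fine] values in [Cloc] is the true one at such [x]. *)
Lemma density_fin_num x : (upper_density mu alpha x < +oo)%E ->
  (0 < lower_density mu alpha x)%E ->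
  exists L U : R, [/\ lower_density mu alpha x = L%:E,
    upper_density mu alpha x = U%:E, 0 < L & L <= U].
Proof.
move=> U_oo L0; have : (lower_density mu alpha x <= upper_density mu alpha x)%E.
  exact: limn_einf_sup.
move: U_oo L0; case: (upper_density mu alpha x) => [U||];
  case: (lower_density mu alpha x) => [L||]// _; rewrite lte_fin lee_fin => L0 LU.
by exists L, U.
Qed.

(** A rational [l] just below the lower density and a rational [u] just above the upper one, each
    within a factor [1 + e], will do. Rational endpoints leave only countably many bands. *)
Lemma density_band_cover e x : 0 < e -> (upper_density mu alpha x < +oo)%E ->
  (0 < lower_density mu alpha x)%E ->
  exists (l u : rat) N, 0 < (ratr l : R) /\ density_band (ratr l) (ratr u) e N x.
Proof.
move=> e0 U_oo L0; have [L [U [LE UE {}L0 LU]]] := density_fin_num U_oo L0.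
have e1 : 0 < 1 + e by rewrite addr_gt0.
have [l] : exists l : rat, ratr l \in `]L / (1 + e), L[.
  by apply: rat_in_itvoo; rewrite ltr_pdivrMr// ltr_pMr// ltrDl.
rewrite in_itv/= => /andP[lL Ll].
have [u] : exists u : rat, ratr u \in `]U, (U * (1 + e))[.
  by apply: rat_in_itvoo; rewrite ltr_pMr ?ltrDl// (lt_le_trans L0).
rewrite in_itv/= => /andP[Uu uU].
have [N1 lN] : exists N, forall n, (N <= n)%N -> ratr l < scaled_mass n x.
  have [|N H] := @limn_einf_gt _ (dens_seq mu alpha x) (ratr l)%:E.
    by rewrite -[limn_einf _]/(lower_density mu alpha x) LE lte_fin.
  by exists N => n /H; rewrite dens_seqE lte_fin.
have [N2 uN] : exists N, forall n, (N <= n)%N -> scaled_mass n x < ratr u.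
  have [|N H] := @limn_esup_lt _ (dens_seq mu alpha x) (ratr u)%:E.
    by rewrite -[limn_esup _]/(upper_density mu alpha x) UE lte_fin.
  by exists N => n /H; rewrite dens_seqE lte_fin.
exists l, u, (maxn N1 N2); split; first by rewrite (lt_trans _ lL)// divr_gt0.
split; first split.
- move=> n; rewrite /= geq_max => /andP[N1n N2n].
  by rewrite (ltW (lN n N1n)) (ltW (uN n N2n)).
- move=> j _; have [|n jn] := @limn_esup_gt _ (dens_seq mu alpha x)
      (ratr u / (1 + e))%:E _ j.
    rewrite -[limn_esup _]/(upper_density mu alpha x) UE lte_fin.
    by rewrite ltr_pdivrMr.
  rewrite dens_seqE lte_fin ltr_pdivrMr// mulrC => uq.
  by exists n => //; exact: ltW.
- move=> j _; have [|n jn] := @limn_einf_lt _ (dens_seq mu alpha x)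
      ((1 + e) * ratr l)%:E _ j.
    rewrite -[limn_einf _]/(lower_density mu alpha x) LE lte_fin.
    by rewrite mulrC -ltr_pdivrMr.
  rewrite dens_seqE lte_fin => ql.
  by exists n => //; exact: ltW.
Qed.

Lemma density_band_exists e : 0 < e -> exists l u N,
  0 < l /\ 0 < fine (mu (density_band l u e N)).
Proof.
move=> e0; apply: contrapT => H.
(* The rational triples are enumerated by [unpickle]; if every band were null, their countable
   union, which is almost all of the space, would be null too. *)
pose F (k : nat) : set (Tm m) :=
  if @unpickle (rat * rat * nat)%type k is Some (l, u, N) then
    [set x | 0 < (ratr l : R) /\ density_band (ratr l) (ratr u) e N x]
  else set0.
have F0 k : mu.-negligible (F k).
  rewrite /F; case: unpickle => [[[l u] N]|]; last exact: negligible_set0.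
  have [l0|l0] := pselect (0 < (ratr l : R)); last first.
    by apply: negligibleS (negligible_set0 mu) => x [].
  apply: (@negligibleS _ _ _ _ (density_band (ratr l) (ratr u) e N)).
    by move=> x [].
  have mE := measurable_density_band (ratr l) (ratr u) e N.
  exists (density_band (ratr l) (ratr u) e N); split => //.
  apply: etrans (measure_fineE hfin mE) _; congr EFin; apply/eqP.
  rewrite eq_le fine_measure_ge0 andbT leNgt; apply/negP => E0.
  by apply: H; exists (ratr l), (ratr u), N.
have /negligibleP : mu.-negligible [set: Tm m].
  have := negligibleU (negligibleU hup hlow) (negligible_bigcup F0).
  apply: negligibleS => x _.
  have [Ux|nUx] := pselect (upper_density mu alpha x < +oo)%E; last by left; left.
  have [Lx|nLx] := pselect (0 < lower_density mu alpha x)%E; last by left; right.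
  right; have [l [u [N [l0 Ex]]]] := density_band_cover e0 Ux Lx.
  apply: (bigcup_sup (i := pickle (l, u, N)) I).
  by rewrite /F pickleK; exact: conj l0 Ex.
by move=> /(_ measurableT) T0; move/eqP: hnz.
Qed.

(** Where the densities [L] and [U] are finite and positive, the recurrence conditions give
    [L <= (1 + e) * l] and [u <= (1 + e) * U]. If the conclusion failed, [U / L] would exceed [c]
    almost everywhere on the band, which has positive measure. *)
Lemma density_band_Cloc l u e N (c : R) : 0 < l -> 0 < e ->
  0 < fine (mu (density_band l u e N)) -> (Cloc mu alpha <= c%:E)%E ->
  u <= (1 + e) ^+ 2 * c * l.
Proof.
move=> l0 e0 E0 /ess_supP hc; apply: contrapT => H.
have /negligibleP : mu.-negligible (density_band l u e N).
  have := negligibleU (negligibleU hup hlow) hc.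
  apply: negligibleS => x [[_ Eu] El].
  have [Ux|nUx] := pselect (upper_density mu alpha x < +oo)%E; last by left; left.
  have [Lx|nLx] := pselect (0 < lower_density mu alpha x)%E; last by left; right.
  right => /=; have [L [U [LE UE L0 LU]]] := density_fin_num Ux Lx.
  rewrite LE UE /= lee_fin ler_pdivrMr// => UL; apply: H.
  have e1 : 0 < 1 + e by rewrite addr_gt0.
  have Ll : L <= (1 + e) * l.
    rewrite -lee_fin -LE; apply: limn_einf_le => j.
    by have [n jn qn] := El j I; exists n => //; rewrite dens_seqE lee_fin.
  have uU : u <= (1 + e) * U.
    rewrite -ler_pdivrMl// -lee_fin -UE; apply: limn_esup_ge => j.
    have [n jn qn] := Eu j I; exists n => //.
    by rewrite dens_seqE lee_fin ler_pdivrMl.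
  have c0 : 0 <= c.
    by rewrite -(pmulr_lge0 _ L0) (le_trans _ UL)// (le_trans (ltW L0)).
  rewrite (le_trans uU)// expr2 -!mulrA ler_pM2l// (le_trans UL)//.
  by rewrite mulrCA ler_wpM2l.
move=> /(_ (measurable_density_band _ _ _ _)) mu0.
by move: E0; rewrite mu0 ltxx.
Qed.

Lemma Cloc_ge (c : R) i : (Cloc mu alpha <= c%:E)%E ->
  (Num.ceil (scale i))%:~R / scale i <= c /\
  scale i / (Num.floor (scale i))%:~R <= c.
Proof.
move=> hc; have M0 := scale_gt0 i.
have F0 : 0 < (Num.floor (scale i))%:~R :> R.
  by rewrite ltr0z floor_gt0 scale_ge1.
have C1 : (Num.ceil (scale i))%:~R - 1 < scale i.
  by have := ceilB1_lt (scale i); rewrite rmorphB.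
have F1 : scale i < (Num.floor (scale i))%:~R + 1.
  by have := floorD1_gt (scale i); rewrite rmorphD.
have C0 := lt_le_trans M0 (ceil_ge (scale i)).
split.
- set C := (Num.ceil (scale i))%:~R in C0 C1 *.
  (* As [C - 1 < scale i], the bound [2 * e * scale i < scale i - (C - 1)] implies
     [(1 + e) * (C - 1) < (1 - e) * scale i]. *)
  pose e0 := Num.min 1 ((scale i - (C - 1)) / (2 * scale i)).
  apply: (@le_of_small_error _ _ _ e0).
  + by rewrite lt_min ltr01 divr_gt0 ?mulr_gt0 ?subr_gt0.
  + by rewrite divr_ge0// ltW.
  move=> e e_gt0; rewrite lt_min => /andP[e1].
  rewrite ltr_pdivlMr ?mulr_gt0// => eM.
  have [l [u [N [l0 E0]]]] := density_band_exists e_gt0.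
  have [+ _] := density_band_ratio i l0 e_gt0 e1 E0
    (density_band_Cloc l0 e_gt0 E0 hc).
  apply; rewrite -/C; nra.
- set C := (Num.floor (scale i))%:~R in F0 F1 *.
  (* The second entry is exactly the threshold for [(1 + e) * scale i < C + 1]. *)
  pose e0 := Num.min 1 ((C + 1 - scale i) / scale i).
  apply: (@le_of_small_error _ _ _ e0).
  + by rewrite lt_min ltr01 divr_gt0 ?subr_gt0.
  + by rewrite divr_ge0// ltW.
  move=> e e_gt0; rewrite lt_min => /andP[e1].
  rewrite ltr_pdivlMr// => eM.
  have [l [u [N [l0 E0]]]] := density_band_exists e_gt0.
  have [_] := density_band_ratio i l0 e_gt0 e1 E0
    (density_band_Cloc l0 e_gt0 E0 hc).
  apply; rewrite -/C; nra.
Qed.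

End density_bands.

Theorem theorem1 (R : realType) (m : nat) (hm : (2 <= m)%N) (alpha : R)
  (halpha : 0 < alpha < 1) (mu : {measure set (Tm m) -> \bar R})
  (hfin : (mu setT < +oo)%E) (hnz : mu setT != 0%E)
  (hup : \forall x \ae mu, (upper_density mu alpha x < +oo)%E)
  (hlow : \forall x \ae mu, (0 < lower_density mu alpha x)%E) :
  (ereal_sup [set (Num.max (powR (m%:R) (alpha * i%:R) /
                              (Num.floor (powR (m%:R) (alpha * i%:R)))%:~R)
                           ((Num.ceil (powR (m%:R) (alpha * j%:R)))%:~R /
                              powR (m%:R) (alpha * j%:R)))%:E
               | i in [set i : nat | (0 < i)%N] & j in [set j : nat | (0 < j)%N]]
   <= Cloc mu alpha)%E.
Proof.
have /andP[alpha0 _] := halpha.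
apply: ge_ereal_sup => _ [i _ [j _ <-]].
have ge c := @Cloc_ge R m hm alpha alpha0 mu hfin hnz hup hlow c.
have {}ge (c : R) : (Cloc mu alpha <= c%:E)%E ->
    Num.max (scale alpha i (m := m) / (Num.floor (scale alpha i (m := m)))%:~R)
      ((Num.ceil (scale alpha j (m := m)))%:~R / scale alpha j (m := m)) <= c.
  by move=> hc; rewrite ge_max (proj2 (ge c i hc)) (proj1 (ge c j hc)).
rewrite -!/(scale _ _); set t := Num.max _ _ in ge *.
(* The value [-oo] is excluded because it would make [t - 1] an upper bound for [t]. *)
case: (Cloc mu alpha) ge => [c||] ge; [|exact: leey|].
  by rewrite lee_fin ge.
by have := ge (t - 1) (leNye _); rewrite lerBrDr gerDl ler10.
Qed.
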